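(* Let $N\geq 2$ be an integer, let $E$ be a vector space and let $d:E\to E$ be a linear endomorphism with $d^N=0$. For $0\leq k\leq N$ let $H^{(k)}=\ker(d^k)/\mathrm{Im}(d^{N-k})$. Let $\ell$ and $m$ be non-negative integers such that $\ell+m\leq N$. Then the hexagon of linear maps $$H^{(m)}\xrightarrow{[i^{\ell}]}H^{(\ell+m)}\xrightarrow{[d^{m}]}H^{(\ell)}\xrightarrow{[i^{N-(\ell+m)}]}H^{(N-m)}\xrightarrow{[d^{\ell}]}H^{(N-(\ell+m))}\xrightarrow{[i^{m}]}H^{(N-\ell)}\xrightarrow{[d^{N-(\ell+m)}]}H^{(m)}$$ (in which the last $H^{(m)}$ is identified with the first) is exact, i.e. at each of its six vertices the kernel of the outgoing map equals the image of the incoming map.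
   Context: Since $d^N=0$, one has $\mathrm{Im}(d^{N-k})\subset\ker(d^k)$ for $0\le k\le N$, so $H^{(k)}$ is well defined, and $H^{(0)}=H^{(N)}=0$. For non-negative integers $r,s$ with $r+s\leq N$: the inclusion $\ker(d^{s})\subset\ker(d^{r+s})$ induces a linear map $[i^{r}]:H^{(s)}\rightarrow H^{(r+s)}$ (as $\mathrm{Im}(d^{N-s})\subset\mathrm{Im}(d^{N-(r+s)})$); and $d^{s}$ maps $\ker(d^{r+s})$ into $\ker(d^{r})$ and $\mathrm{Im}(d^{N-(r+s)})$ into $\mathrm{Im}(d^{N-r})$, hence induces a linear map $[d^{s}]:H^{(r+s)}\rightarrow H^{(r)}$. *)

(* Defs.v *)
From HB Require Import structures.
From mathcomp Require Import all_boot all_algebra boolp.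

Set Implicit Arguments.
Unset Strict Implicit.
Unset Printing Implicit Defensive.

Import GRing.Theory.
Local Open Scope ring_scope.
Local Open Scope quotient_scope.

(* Vector spaces are [lmodType]s over a field, of arbitrary dimension; hence
   membership in the image of a linear map is decided classically ([asbool]). *)

Section KernelImage.
Variables (K : fieldType) (U V : lmodType K) (f : {linear U -> V}).

Definition lin_ker : {pred U} := fun x => f x == 0.
Definition lin_im : {pred V} := fun y => `[< exists x, f x = y >].

Lemma lin_kerP x : reflect (f x = 0) (x \in lin_ker).
Proof. exact: eqP. Qed.

Lemma lin_imP y : reflect (exists x, f x = y) (y \in lin_im).
Proof. exact: asboolP. Qed.

Fact lin_ker_submod : submod_closed lin_ker.
Proof.
split; first by apply/lin_kerP; rewrite linear0.
move=> a x y /lin_kerP fx /lin_kerP fy.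
by apply/lin_kerP; rewrite linearP fx fy scaler0 addr0.
Qed.

Fact lin_im_submod : submod_closed lin_im.
Proof.
split; first by apply/lin_imP; exists 0; rewrite linear0.
move=> a _ _ /lin_imP[x <-] /lin_imP[y <-].
by apply/lin_imP; exists (a *: x + y); rewrite linearP.
Qed.

HB.instance Definition _ := GRing.isSubmodClosed.Build K U lin_ker
  lin_ker_submod.
HB.instance Definition _ := GRing.isSubmodClosed.Build K V lin_im
  lin_im_submod.

End KernelImage.

Definition exact_at (K : fieldType) (U V W : lmodType K)
    (f : {linear U -> V}) (g : {linear V -> W}) : Prop :=
  lin_ker g =i lin_im f.

Section QuotientSpace.
Variables (K : fieldType) (V : lmodType K) (W : submodClosed V).

Definition lquot_mod : {pred V} := fun x => x \in W.

Fact lquot_mod_submod : submod_closed lquot_mod.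
Proof.
by split=> [|a x y xW yW]; rewrite unfold_in /lquot_mod ?rpred0 ?rpredD ?rpredZ.
Qed.
HB.instance Definition _ :=
  GRing.isSubmodClosed.Build K V lquot_mod lquot_mod_submod.

Definition lquot : Type := Quotient.quot lquot_mod.
HB.instance Definition _ := Choice.on lquot.
HB.instance Definition _ := GRing.Zmodule.on lquot.

Definition lpi (x : V) : lquot := \pi_(Quotient.quot lquot_mod) x.
Definition lrepr (q : lquot) : V := repr (q : Quotient.quot lquot_mod).

Lemma lreprK : cancel lrepr lpi.
Proof. exact: reprK. Qed.

Lemma lpi_eq x y : lpi x = lpi y <-> x - y \in W.
Proof.
have -> : (x - y \in W) = (x - y \in lquot_mod) by [].
by rewrite Quotient.idealrBE; split=> [/eqP|/eqP].
Qed.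

Fact lpiD : {morph lpi : x y / x + y}.
Proof. exact: (raddfD \pi_(Quotient.quot lquot_mod)). Qed.

Definition lquot_scale (a : K) (q : lquot) : lquot := lpi (a *: lrepr q).

Fact lpiZ a x : lquot_scale a (lpi x) = lpi (a *: x).
Proof.
by apply/lpi_eq; rewrite -scalerBr rpredZ //; apply/lpi_eq; rewrite lreprK.
Qed.

Fact lquot_scaleA a b q :
  lquot_scale a (lquot_scale b q) = lquot_scale (a * b) q.
Proof. by rewrite -(lreprK q) !lpiZ scalerA. Qed.
Fact lquot_scale1 : left_id 1 lquot_scale.
Proof. by move=> q; rewrite -(lreprK q) lpiZ scale1r. Qed.
Fact lquot_scaleDr : right_distributive lquot_scale +%R.
Proof.
move=> a q r; rewrite -(lreprK q) -(lreprK r).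
by rewrite -lpiD !lpiZ -lpiD scalerDr.
Qed.
Fact lquot_scaleDl q : {morph lquot_scale^~ q : a b / a + b}.
Proof. by move=> a b; rewrite -(lreprK q) !lpiZ -lpiD scalerDl. Qed.

HB.instance Definition _ := GRing.Zmodule_isLmodule.Build K lquot
  lquot_scaleA lquot_scale1 lquot_scaleDr lquot_scaleDl.

Fact lpi_is_linear : linear lpi.
Proof. by move=> a x y; rewrite lpiD -lpiZ. Qed.
HB.instance Definition _ := GRing.isLinear.Build K V lquot *:%R lpi
  lpi_is_linear.

End QuotientSpace.

(* A / B for subspaces A, B of E with B contained in A; without this inclusion
   it is A / (A :&: B). *)
Section Subquotient.
Variables (K : fieldType) (E : lmodType K).

Section Def.
Variables (A B : submodClosed E).

Record subspace := Subspace { subspace_val : E; _ : subspace_val \in A }.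
HB.instance Definition _ := [isSub for subspace_val].
HB.instance Definition _ := [Choice of subspace by <:].
HB.instance Definition _ := [SubChoice_isSubLmodule of subspace by <:].

Definition trace : {pred subspace} := fun u => subspace_val u \in B.

Lemma traceE u : (u \in trace) = (val u \in B).
Proof. by []. Qed.

Fact trace_submod : submod_closed trace.
Proof.
split=> [|a u v]; rewrite !traceE ?raddf0 ?rpred0 // linearP => uB vB.
by rewrite rpredD // rpredZ.
Qed.

HB.instance Definition _ :=
  GRing.isSubmodClosed.Build K subspace trace trace_submod.

Definition subquot : lmodType K := lquot trace.

Definition cls : {linear subspace -> subquot} := @lpi K subspace trace.

Lemma clsP q : exists u, q = cls u.
Proof. by exists (lrepr q); rewrite /cls /= lreprK. Qed.

Lemma cls_eq u v : cls u = cls v <-> val u - val v \in B.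
Proof. by rewrite -raddfB -traceE; exact: lpi_eq. Qed.

Lemma cls_eq0 u : cls u = 0 <-> val u \in B.
Proof. by rewrite -[X in _ = X](linear0 cls) cls_eq -raddfB subr0. Qed.

End Def.
Arguments cls {A} B.

Section Induced.
Variables (A B A' B' : submodClosed E) (f : {linear E -> E}).
Hypothesis (fA : {in A, forall x, f x \in A'}).
Hypothesis (fB : {in B, forall x, f x \in B'}).

Definition restr (u : subspace A) : subspace A' := Subspace (fA (valP u)).

Definition induced_fun (q : subquot A B) : subquot A' B' :=
  cls B' (restr (lrepr q)).

Lemma induced_funE u : induced_fun (cls B u) = cls B' (restr u).
Proof.
apply/cls_eq; rewrite /= -raddfB fB //.
by apply/(cls_eq B); rewrite /cls /= lreprK.
Qed.

Fact induced_is_linear : linear induced_fun.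
Proof.
move=> a p q; have [u ->] := clsP p; have [v ->] := clsP q.
rewrite -linearP !induced_funE -linearP.
by congr (cls B' _); apply/val_inj; rewrite /= !linearP.
Qed.
HB.instance Definition _ := GRing.isLinear.Build K
  (subquot A B) (subquot A' B') *:%R induced_fun induced_is_linear.

Definition induced : {linear subquot A B -> subquot A' B'} := induced_fun.

Lemma inducedE u : induced (cls B u) = cls B' (restr u).
Proof. exact: induced_funE. Qed.

End Induced.
End Subquotient.
Arguments cls {K E A} B.

Section GeneralizedHomology.
Variables (K : fieldType) (E : lmodType K) (d : {linear E -> E}).

Definition dpow (k : nat) : E -> E := iter k d.

Fact dpow_is_linear k : linear (dpow k).
Proof. by move=> a x y; elim: k => //= k ->; rewrite linearP. Qed.
HB.instance Definition _ k :=
  GRing.isLinear.Build K E E *:%R (dpow k) (dpow_is_linear k).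

Lemma dpowD j k x : dpow (j + k) x = dpow j (dpow k x).
Proof. exact: iterD. Qed.

Variable N : nat.

Lemma dpow_im_sub_ker k : (k <= N)%N -> (forall x, dpow N x = 0) ->
  {subset lin_im (dpow (N - k)) <= lin_ker (dpow k)}.
Proof.
move=> kN dN0 _ /lin_imP[x <-]; apply/lin_kerP.
by rewrite /= -dpowD subnKC.
Qed.

(* By dpow_im_sub_ker this is ker(d^k) / Im(d^(N-k)) when d^N = 0. *)
Definition H (k : nat) : lmodType K :=
  subquot (lin_ker (dpow k)) (lin_im (dpow (N - k))).

(* The index t is kept distinct from r + s, so that for instance a map can end
   in H (N - m) when N - m is equal but not convertible to r + s. *)
Section Maps.
Variables (r s t : nat) (rst : (r + s)%N = t) (tN : (t <= N)%N).

Fact incl_ker : {in lin_ker (dpow s), forall x, idfun x \in lin_ker (dpow t)}.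
Proof.
by move=> x /lin_kerP/= x0; apply/lin_kerP; rewrite /= -rst dpowD x0 linear0.
Qed.

Fact incl_im :
  {in lin_im (dpow (N - s)), forall x, idfun x \in lin_im (dpow (N - t))}.
Proof.
move=> _ /lin_imP[x <-]; apply/lin_imP; exists (dpow r x).
rewrite /= -dpowD -rst addnC [(r + s)%N]addnC subnDA subnKC //.
by rewrite -(leq_add2r s) subnK ?rst // (leq_trans _ tN) // -rst leq_addl.
Qed.

Fact dpow_ker :
  {in lin_ker (dpow t), forall x, dpow s x \in lin_ker (dpow r)}.
Proof. by move=> x /lin_kerP/=; rewrite -rst dpowD => x0; apply/lin_kerP. Qed.

Fact dpow_im :
  {in lin_im (dpow (N - t)), forall x, dpow s x \in lin_im (dpow (N - r))}.
Proof.
move=> _ /lin_imP[x <-]; apply/lin_imP; exists x.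
rewrite /= -dpowD -rst subnDA subnKC //.
by rewrite -(leq_add2l r) rst subnKC // (leq_trans _ tN) // -rst leq_addr.
Qed.

(* [i^r] : H^(s) -> H^(r+s) *)
Definition imap : {linear H s -> H t} := induced incl_ker incl_im.

(* [d^s] : H^(r+s) -> H^(r) *)
Definition dmap : {linear H t -> H r} := induced dpow_ker dpow_im.

Lemma imapE (u : subspace (lin_ker (dpow s)))
    (v : subspace (lin_ker (dpow t))) :
  val u = val v -> imap (cls _ u) = cls _ v.
Proof. by rewrite /imap inducedE => uv; congr (cls _ _); apply/val_inj. Qed.

Lemma dmapE (u : subspace (lin_ker (dpow t)))
    (v : subspace (lin_ker (dpow r))) :
  dpow s (val u) = val v -> dmap (cls _ u) = cls _ v.
Proof. by rewrite /dmap inducedE => uv; congr (cls _ _); apply/val_inj. Qed.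

End Maps.
End GeneralizedHomology.

Arguments imap {K E} d {N} r s {t} rst tN.
Arguments dmap {K E} d {N} r s {t} rst tN.

Section HexagonIndices.
Variables (N l m : nat) (lmN : (l + m <= N)%N).

Lemma hexagon_subm : (N - (l + m) + l = N - m)%N.
Proof.
rewrite addnC [(l + m)%N]addnC subnDA subnKC // leq_subRL 1?addnC //.
by rewrite (leq_trans _ lmN) ?leq_addl.
Qed.

Lemma hexagon_subl : (m + (N - (l + m)) = N - l)%N.
Proof.
by rewrite subnDA subnKC // leq_subRL // (leq_trans _ lmN) ?leq_addr.
Qed.

End HexagonIndices.

(* Main.v *)
(* Both kinds of vertices reduce to chasing one element. At H^(r+s), between
   [i^r] and [d^s]: if d^s x = d^(N-r) y, then x - d^(N-(r+s)) y lies in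
   ker(d^s) and has the class of x. At H^(r), between [d^s] : H^(r+s) -> H^(r)
   and the inclusion into H^(N-s): a class is killed by the inclusion iff it is
   represented by some d^s y, and then y lies in ker(d^(r+s)). *)

Require Import Defs.
From mathcomp Require Import all_boot all_algebra.

Import GRing.Theory.
Local Open Scope ring_scope.

Section Exactness.
Variables (K : fieldType) (E : lmodType K) (d : {linear E -> E}) (N : nat).

(** The composite vanishes because [d^s] kills representatives in [ker(d^s)]. This serves the
    vertices of index [l + m], [N - m] and [N - l]. *)
Lemma exact_imap_dmap (r s t : nat) (rst : (r + s)%N = t) (tN : (t <= N)%N) :
  exact_at (imap d r s rst tN) (dmap d r s rst tN).
Proof.
move=> q; apply/lin_kerP/lin_imP.
- have [u ->] := clsP q.
  rewrite /dmap (inducedE _ (dpow_im rst tN)) => /cls_eq0/lin_imP[y /= dyu].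
  have ker_v : val u - dpow d (N - t) y \in lin_ker (dpow d s).
    apply/lin_kerP; rewrite linearB /= -dpowD.
    (* With this exponent, [d^s] sends the correction term to [d^(N-r) y = d^s u]. *)
    suff -> : (s + (N - t) = N - r)%N by rewrite dyu subrr.
    rewrite -rst subnDA subnKC // leq_subRL ?rst //.
    by apply: leq_trans tN; rewrite -rst leq_addr.
  exists (cls _ (Subspace ker_v)); rewrite /imap (inducedE _ (incl_im rst tN)).
  (* The new representative minus [u] is [- d^(N-t) y]. *)
  apply/cls_eq/lin_imP; exists (- y).
  by rewrite linearN /= addrAC subrr add0r.
- case=> p <-; have [u ->] := clsP p.
  rewrite /imap (inducedE _ (incl_im rst tN)) /dmap (inducedE _ (dpow_im rst tN)).
  by apply/cls_eq0 => /=; have /lin_kerP/= -> := valP u; rewrite rpred0.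
Qed.

(** The condition [N - t' = s] makes [Im(d^s)] exactly what is divided out in [H^(t')]. This serves
    the vertices of index [l], [p] and [m]. *)
Lemma exact_dmap_imap (r s t r' t' : nat) (rst : (r + s)%N = t)
    (tN : (t <= N)%N) (rrt' : (r' + r)%N = t') (t'N : (t' <= N)%N) :
  (N - t')%N = s -> exact_at (dmap d r s rst tN) (imap d r' r rrt' t'N).
Proof.
move=> Nt's q; apply/lin_kerP/lin_imP.
- have [u ->] := clsP q.
  rewrite /imap (inducedE _ (incl_im rrt' t'N)) => /cls_eq0/lin_imP[y /=].
  rewrite Nt's => dyu.
  (* [d^t y = d^r (d^s y) = d^r u = 0]. *)
  have ker_y : y \in lin_ker (dpow d t).
    by apply/lin_kerP; rewrite /= -rst dpowD dyu; apply/lin_kerP/(valP u).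
  by exists (cls _ (Subspace ker_y)); apply: dmapE.
- case=> p <-; have [u ->] := clsP p.
  rewrite /dmap (inducedE _ (dpow_im rst tN)) /imap (inducedE _ (incl_im rrt' t'N)).
  apply/cls_eq0/lin_imP => /=.
  by rewrite Nt's; exists (val u).
Qed.

End Exactness.

Theorem lemma1 (K : fieldType) (E : lmodType K) (d : {linear E -> E})
    (N l m : nat) (N_ge2 : (2 <= N)%N) (dN0 : forall x, dpow d N x = 0)
    (lmN : (l + m <= N)%N) :
  let p := (N - (l + m))%N in
  let f1 : {linear H d N m -> H d N (l + m)} :=
    imap d l m (erefl (l + m)%N) lmN in
  let f2 : {linear H d N (l + m) -> H d N l} :=
    dmap d l m (erefl (l + m)%N) lmN in
  let f3 : {linear H d N l -> H d N (N - m)} :=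
    imap d p l (hexagon_subm lmN) (leq_subr m N) in
  let f4 : {linear H d N (N - m) -> H d N p} :=
    dmap d p l (hexagon_subm lmN) (leq_subr m N) in
  let f5 : {linear H d N p -> H d N (N - l)} :=
    imap d m p (hexagon_subl lmN) (leq_subr l N) in
  let f6 : {linear H d N (N - l) -> H d N m} :=
    dmap d m p (hexagon_subl lmN) (leq_subr l N) in
  exact_at f1 f2 /\ exact_at f2 f3 /\ exact_at f3 f4 /\
  exact_at f4 f5 /\ exact_at f5 f6 /\ exact_at f6 f1.
Proof.
move=> p f1 f2 f3 f4 f5 f6.
have [lN mN] : (l <= N)%N /\ (m <= N)%N.
  by split; rewrite (leq_trans _ lmN) ?leq_addr ?leq_addl.
split; first exact: exact_imap_dmap.
split; first by apply: exact_dmap_imap; rewrite subKn.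
split; first exact: exact_imap_dmap.
split; first by apply: exact_dmap_imap; rewrite subKn.
split; first exact: exact_imap_dmap.
(* Closing the hexagon, the side condition is [N - (l + m) = p], true by definition of [p]. *)
exact: exact_dmap_imap.
Qed.
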